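(* Let $\phi:\mathbb R\to[0,\infty)$ be even, continuous, non-decreasing on $[0,\infty)$, with $\phi(x)/|x|\to\infty$ as $|x|\to\infty$, and let $B\in\mathbb R$ with $\phi(0)<B$. Let $\Delta>0$, $r\in\mathbb R$, and let $\psi:\mathbb R\to\mathbb R$ be non-decreasing. Suppose $$\sup_{P\in\mathcal C_0}\log E_P[\exp(\psi(X-\Delta))]+r\le0\qquad\text{and}\qquad\sup_{P\in\mathcal C_0}\log E_P[\exp(-\psi(X+\Delta))]+r\le0 .$$ Then for every $n\ge1$ and every measurable $\mu_n:\mathbb R^n\to\mathbb R$ that is an $M$-estimator for $\psi$ (should one exist), i.e. such that for every sample $(X_1,\dots,X_n)\in\mathbb R^n$ $$\sum_{i=1}^n\psi(X_i-\theta)\ge0\ \text{ for all }\theta<\mu_n,\qquad \sum_{i=1}^n\psi(X_i-\theta)\le0\ \text{ for all }\theta>\mu_n,$$ one has $$\max\bigl(P_\mu[\mu_n-\mu>\Delta],\,P_\mu[\mu_n-\mu<-\Delta]\bigr)\le e^{-nr}\qquad\text{for all }\mu\in\mathbb R\text{ and }P_\mu\in\mathcal C_\mu .$$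
   Context: For $\mu\in\mathbb R$, $\mathcal C_\mu$ is the set of Borel probability measures $P$ on $\mathbb R$ with $\int x\,dP=\mu$ and $\int\phi(x-\mu)\,dP\le B$. Under $P_\mu$ the observations $X_1,\dots,X_n$ are i.i.d. with law $P_\mu$. *)

(* Defs.v *)
From HB Require Import structures.
From mathcomp Require Import all_boot all_order all_algebra.
From mathcomp Require Import all_classical all_reals all_analysis.

Set Implicit Arguments.
Unset Strict Implicit.
Unset Printing Implicit Defensive.

Import Order.TTheory GRing.Theory Num.Theory.
Import numFieldNormedType.Exports.

Local Open Scope classical_set_scope.
Local Open Scope ring_scope.

(* [R] itself carries its Borel sigma-algebra, so [probability R R] is the type
   of Borel probability measures on the real line.  Integrability of the
   identity is explicit because the integral of a non-integrable function is a
   totalized value. *)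
Definition moment_class (R : realType) (phi : R -> R) (B mu : R) :
    set (probability R R) :=
  [set P | [/\ P.-integrable [set: R] (EFin \o (@idfun R)),
               (\int[P]_x x%:E = mu%:E)%E
             & (\int[P]_x (phi (x - mu))%:E <= B%:E)%E]].

Definition M_estimator (R : realType) (psi : R -> R) (n : nat)
    (mu_n : n.-tuple R -> R) : Prop :=
  forall x : n.-tuple R,
    (forall theta : R, theta < mu_n x -> 0 <= \sum_(i < n) psi (tnth x i - theta))
    /\
    (forall theta : R, mu_n x < theta -> \sum_(i < n) psi (tnth x i - theta) <= 0).

(* Mutual independence: the product rule over every subfamily [J]. *)
Definition mutually_independent (R : realType) (d : measure_display)
    (Omega : measurableType d) (Pr : probability Omega R) (n : nat)
    (X : 'I_n -> {RV Pr >-> R}) : Prop :=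
  forall (J : {set 'I_n}) (A : 'I_n -> set R),
    (forall i, measurable (A i)) ->
    (Pr [set w | forall i, i \in J -> A i (X i w)]
     = \prod_(i in J) Pr (X i @^-1` A i))%E.

(* Two measures are identified when they agree on measurable sets; as set
   functions their values elsewhere are irrelevant. *)
Definition iid_with_law (R : realType) (d : measure_display)
    (Omega : measurableType d) (Pr : probability Omega R) (n : nat)
    (X : 'I_n -> {RV Pr >-> R}) (P : probability R R) : Prop :=
  mutually_independent X /\
  forall (i : 'I_n) (A : set R), measurable A -> distribution Pr (X i) A = P A.

Definition sample (R : realType) (d : measure_display)
    (Omega : measurableType d) (Pr : probability Omega R) (n : nat)
    (X : 'I_n -> {RV Pr >-> R}) (w : Omega) : n.-tuple R :=
  [tuple X i w | i < n].

(* Main.v *)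
(* Chernoff's bound: if [mu_n > mu + Delta], the estimating sum at
   [theta = mu + Delta < mu_n] is nonnegative, so Markov's inequality applied to
   its exponential, together with independence, bounds the probability by the
   [n]-th power of the one-observation exponential moment. Translating the law
   by [mu] puts it in the class centered at [0], so that moment is at most
   [exp (- r)]. The lower tail is symmetric. *)

Require Import Defs.
From HB Require Import structures.
From mathcomp Require Import all_boot all_order all_algebra.
From mathcomp Require Import all_classical all_reals all_analysis.
From mathcomp Require Import measurable_realfun.

Import Order.TTheory GRing.Theory Num.Theory.
Import numFieldNormedType.Exports.

Local Open Scope classical_set_scope.
Local Open Scope ring_scope.

(** * Integration against a weighted image measure *)

Section SimpleApproximation.
Import HBNNSimple.

(** Both sides are additive in [f] and pass to monotone limits, so the identity on indicators
    extends through simple functions. Here [nu] is the image under [X] of the measure with density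
    [Z]; this serves to replace one factor of a product of random variables at a time. *)
Lemma ge0_integralM_comp (R : realType) (d d' : measure_display) (T : measurableType d)
  (T' : measurableType d') (mu : {measure set T -> \bar R})
  (nu : {measure set T' -> \bar R}) (X : T -> T') (Z : T -> R) (f : T' -> R) :
  measurable_fun [set: T] X -> measurable_fun [set: T] Z ->
  (forall t, 0 <= Z t) ->
  (forall A, measurable A -> (\int[mu]_t (\1_A (X t) * Z t)%:E = nu A)%E) ->
  measurable_fun [set: T'] f -> (forall y, 0 <= f y) ->
  (\int[mu]_t (f (X t) * Z t)%:E = \int[nu]_y (f y)%:E)%E.
Proof.
move=> mX mZ Z0 XZ mf f0.
have mEf : measurable_fun [set: T'] (EFin \o f : T' -> \bar R) by exact/measurable_EFinP.
pose f_ := nnsfun_approx measurableT mEf.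
have cvgf y : EFin (f_ n y) @[n --> \oo] --> (f y)%:E.
  by apply: (@cvg_nnsfun_approx _ _ _ setT measurableT (EFin \o f)) => // *; rewrite lee_fin.
have ndf y : {homo (fun n => f_ n y) : m n / (m <= n)%N >-> m <= n}.
  by move=> m n mn; exact/lefP/nd_nnsfun_approx.
have mf_ n : measurable_fun [set: T'] (f_ n) by exact: measurable_funP.
(* Monotone convergence applies on both sides: the sign of [Z] keeps [f_ n (X t) * Z t]
   non-decreasing in [n]. *)
transitivity (limn (fun n => \int[nu]_y (f_ n y)%:E))%E; last first.
  rewrite -monotone_convergence//.
  - by apply: eq_integral => y _; exact/cvg_lim.
  - by move=> n; exact/measurable_EFinP.
  - by move=> n y _; rewrite lee_fin.
  - by move=> y _ m n mn; rewrite lee_fin ndf.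
rewrite (_ : (fun n => _) = (fun n => \int[mu]_t (f_ n (X t) * Z t)%:E)%E).
  rewrite -monotone_convergence//.
  - apply: eq_integral => t _; apply/esym/cvg_lim => //.
    under eq_fun do rewrite EFinM.
    by rewrite EFinM; apply: cvgeZr.
  - move=> n; apply/measurable_EFinP/measurable_funM => //.
    exact: measurableT_comp.
  - by move=> n t _; rewrite lee_fin mulr_ge0.
  - by move=> t _ m n mn; rewrite lee_fin ler_wpM2r// ndf.
apply/funext => n.
have fE y : (f_ n y)%:E = (\sum_(k \in range (f_ n))
    (k * \1_(f_ n @^-1` [set k]) y)%:E)%E by rewrite fsumEFin// -fimfunE.
have mX1 (A : set T') : measurable A ->
    measurable_fun [set: T] (fun t => \1_A (X t) : R).
  move=> mA; apply: (@measurableT_comp _ _ _ _ _ _ (\1_A : T' -> R)) => //.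
transitivity (\sum_(k \in range (f_ n)) k%:E * nu (f_ n @^-1` [set k]))%E.
  under eq_integral do rewrite fE.
  rewrite ge0_integral_fsum//; last 2 first.
  - by move=> k; exact/measurable_EFinP/measurable_funM.
  - by move=> k y _; rewrite nnfun_muleindic_ge0.
  apply: eq_fsbigr => k _.
  by rewrite integralZl_indic_nnsfun// integral_indic// setIT.
under [RHS]eq_integral => t _.
  rewrite EFinM fE ge0_mule_fsuml; last by move=> k; rewrite nnfun_muleindic_ge0.
  over.
rewrite /= ge0_integral_fsum//; last 2 first.
- move=> k; apply/measurable_EFinP/measurable_funM => //.
  by apply: measurable_funM => //; exact: mX1.
- by move=> k t _; rewrite mule_ge0// ?nnfun_muleindic_ge0// lee_fin.
(* Writing [k] as a value of [f_ n] shows that it is nonnegative, so it can be taken out of the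
   integral. *)
apply: eq_fsbigr => k /[!inE] -[y _ <-].
under [RHS]eq_integral do rewrite -EFinM -mulrA EFinM.
rewrite ge0_integralZl_EFin//.
- by rewrite XZ.
- by move=> t _; rewrite lee_fin mulr_ge0.
- apply/measurable_EFinP/measurable_funM => //; exact: mX1.
Qed.
End SimpleApproximation.

(** Carries mutual independence, which is stated for events, over to nonnegative functions of the
    variables. *)
Lemma expectation_prod_independent (R : realType) (d : measure_display)
    (Omega : measurableType d) (Pr : probability Omega R) (n : nat)
    (X : 'I_n -> {RV Pr >-> R}) (h : 'I_n -> R -> R) :
  mutually_independent X ->
  (forall i, measurable_fun [set: R] (h i)) ->
  (forall i x, 0 <= h i x) ->
  (forall i, 'E_Pr[h i \o X i] < +oo)%E ->
  ('E_Pr[fun w => (\prod_i h i (X i w))%R] = \prod_i 'E_Pr[h i \o X i])%E.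
Proof.
move=> indX mh h0 hoo.
have mhX i g : measurable_fun [set: R] g -> measurable_fun [set: Omega] (g \o X i : Omega -> R).
  by move=> mg; exact: measurableT_comp.
(* Induction on the set of indices whose [h i] is not known to be an indicator:
   the base case is independence of events, and each step passes from indicators
   to arbitrary [h i] in one coordinate. *)
have : forall i, i \notin enum 'I_n ->
    exists2 A : set R, measurable A & h i = \1_A by move=> i; rewrite mem_enum.
elim: (enum 'I_n) h mh h0 hoo => [|i s IH] h mh h0 hoo hA.
  have /choice[A PA] : forall i, exists A : set R, measurable A /\ h i = \1_A.
    by move=> i; have [//|A mA hiA] := hA i; exists A.
  have mXA i : measurable (X i @^-1` A i).
    by rewrite -[X in measurable X]setTI; apply: measurable_funP => //; exact: (PA i).1.
  have hXA i w : h i (X i w) = \1_(X i @^-1` A i) w.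
    by rewrite (PA i).2 !indicE.
  (* The idle-looking membership makes [S] literally the event of the product rule for the full
     index set. *)
  pose S := [set w | forall i, i \in [set: 'I_n]%SET -> A i (X i w)].
  have prodS w : \prod_i h i (X i w) = \1_S w.
    rewrite indicE; case: (boolP (w \in S)) => [/set_mem Sw|Sw].
      rewrite big1// => i _; rewrite hXA indicE mem_set//; apply: Sw.
      by rewrite inE.
    apply/eqP/prodf_eq0.
    have [i Hi] : exists i, ~ A i (X i w).
      apply/existsNP => H; move/negP: Sw; apply; rewrite inE => i _; exact: H.
    by exists i => //; rewrite hXA indicE memNset.
  have mS : measurable S.
    rewrite (_ : S = \bigcap_(i in [set: 'I_n]) (X i @^-1` A i)).
      by apply: fin_bigcap_measurable => //; exact: finite_finset.
    apply/seteqP; split => [w Sw i _|w Sw i _]; last exact: Sw.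
    by apply: Sw; rewrite inE.
  rewrite unlock; under eq_integral do rewrite prodS.
  rewrite integral_indic// setIT.
  apply: (etrans (indX [set: 'I_n]%SET A (fun i => (PA i).1))).
  apply: eq_big => [i|i _]; first by rewrite inE.
  under [RHS]eq_integral do rewrite /= hXA.
  by rewrite integral_indic// setIT.
(* Finiteness of the expectations makes this product a real number, so that it can scale a
   measure. *)
pose c := fine (\prod_(j | j != i) 'E_Pr[h j \o X j])%E.
have Eh0 j : (0 <= 'E_Pr[h j \o X j])%E by apply: expectation_ge0 => w; exact: h0.
have Efin j : 'E_Pr[h j \o X j]%E = (fine 'E_Pr[h j \o X j])%:E.
  by rewrite fineK// ge0_fin_numE.
have cE : (c%:E = \prod_(j | j != i) 'E_Pr[h j \o X j])%E.
  rewrite fineK//; under eq_bigr do rewrite Efin.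
  by rewrite prodEFin.
have c0 : 0 <= c by rewrite -lee_fin cE; apply: prode_ge0.
pose Z w := \prod_(j | j != i) h j (X j w).
have mZ : measurable_fun [set: Omega] Z.
  rewrite /Z; under eq_fun do rewrite -big_filter.
  by apply: measurable_prod => j _; exact: mhX.
have Z0 w : 0 <= Z w by apply: prodr_ge0.
rewrite [RHS](bigD1 i)//= -cE unlock.
under eq_integral do rewrite (bigD1 i)//=.
(* The image under [X i] of [Pr] weighted by [Z] is [c] times the law of [X i]. On an indicator
   [\1_A] this is the induction hypothesis for [h'], where coordinate [i] has become an indicator
   and so may leave the list. *)
rewrite (@ge0_integralM_comp _ _ _ _ _ Pr
  (mscale (NngNum c0) (distribution Pr (X i))) (X i) Z)//; last first.
  move=> A mA.
  pose h' j := if j == i then \1_A else h j.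
  have h'i : h' i = \1_A by rewrite /h' eqxx.
  have h'j j : j != i -> h' j = h j by rewrite /h' => /negPf ->.
  have mXA : measurable (X i @^-1` A).
    by rewrite -[X in measurable X]setTI; exact: measurable_funP.
  have Eh'i : 'E_Pr[h' i \o X i]%E = Pr (X i @^-1` A).
    rewrite h'i -(setIT (_ @^-1` _)) -integral_indic// unlock.
    by apply: eq_integral => w _; rewrite /= !indicE.
  transitivity 'E_Pr[fun w => (\prod_j h' j (X j w))%R]%E.
    rewrite unlock; apply: eq_integral => w _; congr EFin.
    rewrite [RHS](bigD1 i)//= h'i; congr (_ * _).
    by apply: eq_bigr => j ji; rewrite h'j.
  rewrite IH.
  - rewrite (bigD1 i)//= Eh'i muleC /mscale/= cE; congr (_ * _)%E.
    by apply: eq_bigr => j ji; rewrite h'j.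
  - move=> j; have [->|ji] := eqVneq j i; last by rewrite h'j.
    by rewrite h'i; exact: measurable_indic.
  - move=> j x; have [->|ji] := eqVneq j i; last by rewrite h'j.
    by rewrite h'i.
  - move=> j; have [->|ji] := eqVneq j i; last by rewrite h'j.
    by rewrite Eh'i (le_lt_trans (probability_le1 _ _))// ltry.
  - move=> j js; have [->|ji] := eqVneq j i; first by exists A; rewrite ?h'i.
    by rewrite h'j//; apply: hA; rewrite in_cons negb_or ji.
rewrite ge0_integral_mscale//; last 2 first.
- exact/measurable_EFinP.
- by move=> x _; rewrite lee_fin.
rewrite muleC; congr (_ * _)%E.
rewrite ge0_integral_distribution//; first exact/measurable_EFinP.
by move=> x; rewrite lee_fin.
Qed.

(** * Centring the law, and the exponential bound for one tail *)

(** The witness is the law of [x - mu] under [P], and every clause is a change of variables. The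
    transfer formula is kept to nonnegative [f], where no integrability has to be checked;
    exponentials are of this kind. *)
Lemma moment_class_center (R : realType) (phi : R -> R) (B mu : R)
    (P : probability R R) :
  continuous phi -> (forall x, 0 <= phi x) -> moment_class phi B mu P ->
  exists2 Q : probability R R, moment_class phi B 0 Q &
    forall f : R -> R, measurable_fun [set: R] f -> (forall x, 0 <= f x) ->
      ('E_Q[f] = 'E_P[fun x => f (x - mu)%R])%E.
Proof.
move=> phi_cont phi0 [intP EP EphiP].
have msub : measurable_fun [set: R] (fun x : R => x - mu).
  by apply: measurable_funB.
pose sub : {mfun R >-> R} :=
  HB.pack (fun x : R => x - mu) (isMeasurableFun.Build _ _ _ _ _ msub).
have intsub : P.-integrable [set: R] (EFin \o sub).
  exact: (integrableB measurableT intP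
    (finite_measure_integrable_cst P mu measurableT)).
have mid : measurable_fun [set: R] (EFin \o @idfun R : R -> \bar R).
  by apply/measurable_EFinP; exact: measurable_id.
exists (distribution P sub); last first.
  move=> f mf f0; rewrite unlock ge0_integral_distribution//.
  exact/measurable_EFinP.
split.
- by apply: integrable_pushforward.
- rewrite (@integral_distribution _ _ _ _ _ P sub (EFin \o @idfun R))//=.
  under eq_integral do rewrite EFinB.
  rewrite (@integralB_EFin _ _ _ _ _ idfun (cst mu))//; last first.
    exact: finite_measure_integrable_cst.
  have -> : (\int[P]_x (cst mu x)%:E = mu%:E)%E.
    by rewrite -[RHS](expectation_cst P) unlock.
  by rewrite [X in (X - _)%E]EP subee.
- rewrite ge0_integral_distribution//; last by move=> x; rewrite lee_fin.
    by under eq_integral do rewrite /= subr0.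
  apply/measurable_EFinP.
  under eq_fun do rewrite subr0.
  exact: continuous_measurable_fun.
Qed.

(** The product of the [expR (g (X i w))] is at least 1 on [E], hence dominates the indicator of [E]
    everywhere. The event and [g] are left abstract so that both tails are instances. *)
Lemma chernoff_iid (R : realType) (d : measure_display)
    (Omega : measurableType d) (Pr : probability Omega R) (n : nat)
    (X : 'I_n -> {RV Pr >-> R}) (P : probability R R) (g : R -> R) (r : R)
    (E : set Omega) :
  iid_with_law X P -> measurable_fun [set: R] g ->
  ('E_P[expR \o g] <= (expR (- r))%:E)%E ->
  measurable E -> (forall w, E w -> 0 <= \sum_(i < n) g (X i w)) ->
  (Pr E <= (expR (- (n%:R * r)))%:E)%E.
Proof.
move=> [indX lawX] mg Eg mE E_sum.
have meg : measurable_fun [set: R] (expR \o g) by exact: measurableT_comp.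
have EgX i : ('E_Pr[(expR \o g) \o X i] = 'E_P[expR \o g])%E.
  transitivity ('E_(distribution Pr (X i))[expR \o g])%E; rewrite unlock.
    rewrite ge0_integral_distribution//; first exact/measurable_EFinP.
    by move=> x; rewrite lee_fin expR_ge0.
  (* An integral depends only on the values of the measure on measurable sets, which is all that
     [iid_with_law] provides. *)
  by apply: eq_measure_integral => A mA _; exact: lawX.
have Efin : ('E_P[expR \o g] = (fine 'E_P[expR \o g])%:E)%E.
  rewrite fineK// ge0_fin_numE; first exact: le_lt_trans Eg (ltry _).
  by apply: expectation_ge0 => x; exact: expR_ge0.
apply: (@le_trans _ _ 'E_Pr[fun w => (\prod_i (expR \o g) (X i w))%R]%E).
  rewrite -expectation_indic//; apply: expectation_le => //.
  - by apply: measurable_prod => i _; exact: measurableT_comp.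
  - by move=> w; apply: prodr_ge0 => i _; exact: expR_ge0.
  apply: aeW => w; rewrite /= -expR_sum indicE.
  have [/set_mem/E_sum|_] := boolP (w \in E); last exact: expR_ge0.
  by move=> sum_ge0; rewrite -[leLHS]expR0 ler_expR.
rewrite (@expectation_prod_independent _ _ _ _ _ _ (fun=> expR \o g))//.
- under eq_bigr do rewrite EgX Efin.
  rewrite prodEFin prodr_const card_ord lee_fin.
  rewrite -mulrN mulrC expRM_natr lerXn2r ?nnegrE ?expR_ge0//.
    by apply: fine_ge0; apply: expectation_ge0 => x; exact: expR_ge0.
  by rewrite -lee_fin -Efin.
- by move=> i x; exact: expR_ge0.
- by move=> i; rewrite EgX (le_lt_trans Eg)// ltry.
Qed.

(** Turns the supremum condition over centred laws into a bound on the moment under a law with mean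
    [mu]: centre it, bound its logarithm by the supremum, exponentiate. *)
Lemma expectation_le_expRN (R : realType) (phi g : R -> R) (B mu r : R)
    (P : probability R R) :
  continuous phi -> (forall x, 0 <= phi x) -> moment_class phi B mu P ->
  measurable_fun [set: R] g ->
  (ereal_sup [set lne 'E_Q[fun x : R => expR (g x)]
             | Q in moment_class phi B 0] + r%:E <= 0)%E ->
  ('E_P[fun x => expR (g (x - mu))%R] <= (expR (- r))%:E)%E.
Proof.
move=> phi_cont phi0 /moment_class_center-/(_ phi_cont phi0)[Q Q0 QP] mg supg.
rewrite -(QP (expR \o g)) => [|| x]; last exact: expR_ge0; last first.
  exact: measurableT_comp.
have EQ0 : (0 <= 'E_Q[expR \o g])%E.
  by apply: expectation_ge0 => x; exact: expR_ge0.
(* The inversion holds on all of [[0, +oo]], so finiteness of the moment comes out of the bound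
   itself. *)
rewrite -[leRHS]/(expeR (- r%:E)%E) -[leLHS]lneK; last first.
  by rewrite in_itv/= EQ0 leey.
rewrite lee_expeR -[leRHS]add0e leeBrDr//; apply: le_trans supg.
by rewrite leeD2r//; apply: ereal_sup_ubound; exists Q.
Qed.

(** * The two deviation probabilities *)

Theorem theorem1 (R : realType) (phi : R -> R) (B Delta r : R) (psi : R -> R)
  (phi_ge0 : forall x : R, 0 <= phi x)
  (phi_even : forall x : R, phi (- x) = phi x)
  (phi_cont : continuous phi)
  (phi_ndecr : forall x y : R, 0 <= x -> x <= y -> phi x <= phi y)
  (phi_superlinear : (phi x / `|x| @[x --> +oo] --> +oo) /\
                     (phi x / `|x| @[x --> -oo] --> +oo))
  (phi0_lt_B : phi 0 < B)
  (Delta_gt0 : 0 < Delta)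
  (psi_ndecr : forall x y : R, x <= y -> psi x <= psi y)
  (upper_cond :
    (ereal_sup [set lne 'E_P[fun x : R => expR (psi (x - Delta)%R)]
               | P in moment_class phi B 0] + r%:E <= 0)%E)
  (lower_cond :
    (ereal_sup [set lne 'E_P[fun x : R => expR (- psi (x + Delta)%R)%R]
               | P in moment_class phi B 0] + r%:E <= 0)%E) :
  forall (n : nat) (mu_n : n.-tuple R -> R),
    (1 <= n)%N ->
    measurable_fun [set: n.-tuple R] mu_n ->
    M_estimator psi mu_n ->
    forall (mu : R) (P_mu : probability R R),
      moment_class phi B mu P_mu ->
      forall (d : measure_display) (Omega : measurableType d)
             (Pr : probability Omega R) (X : 'I_n -> {RV Pr >-> R}),
        iid_with_law X P_mu ->
        (Order.max (Pr [set w | (mu_n (sample X w) - mu > Delta)%R])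
                   (Pr [set w | (mu_n (sample X w) - mu < - Delta)%R])
         <= (expR (- (n%:R * r)))%:E)%E.
Proof.
move=> n mu_n _ m_mu_n estim mu P Pclass d Omega Pr X iidX.
have mpsi : measurable_fun [set: R] psi by exact: nondecreasing_measurable.
have sampleE w i : tnth (sample X w) i = X i w by exact: tnth_mktuple.
have mest : measurable_fun [set: Omega] (mu_n \o sample X).
  apply: measurableT_comp => //; apply/measurable_fun_tnthP => i.
  rewrite (_ : _ \o _ = X i :> (Omega -> R)); first exact: measurable_funP.
  by apply/funext => w; exact: sampleE.
have m_up : measurable_fun [set: R] (fun x => psi (x - Delta)).
  by apply: measurableT_comp => //; exact: measurable_funB.
have m_lo : measurable_fun [set: R] (fun x => - psi (x + Delta)).
  apply: measurableT_comp => //; apply: measurableT_comp => //.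
  exact: measurable_funD.
rewrite ge_max; apply/andP; split.
(* In this form [g] is the integrand of [upper_cond] translated by [mu]; it is regrouped below as
   [psi] at [theta = mu + Delta]. *)
- apply: (@chernoff_iid _ _ _ _ _ _ _ (fun x => psi (x - mu - Delta)) _ _ iidX).
  + by apply: (measurableT_comp m_up); exact: measurable_funB.
  + exact: (@expectation_le_expRN _ _ _ _ _ _ _ phi_cont phi_ge0 Pclass m_up
      upper_cond).
  + rewrite -[X in measurable X]setTI.
    rewrite (_ : [set w | _] = (mu_n \o sample X) @^-1` `]mu + Delta, +oo[%classic).
      exact: mest.
    by apply/funext => w /=; rewrite in_itv/= andbT ltrBrDl.
  + move=> w /= lt_est.
    rewrite (eq_bigr (fun i => psi (tnth (sample X w) i - (mu + Delta)))).
      by apply: (estim _).1; rewrite -ltrBrDl.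
    by move=> i _; rewrite sampleE opprD addrA.
- apply: (@chernoff_iid _ _ _ _ _ _ _ (fun x => - psi (x - mu + Delta)) _ _ iidX).
  + by apply: (measurableT_comp m_lo); exact: measurable_funB.
  + exact: (@expectation_le_expRN _ _ _ _ _ _ _ phi_cont phi_ge0 Pclass m_lo
      lower_cond).
  + rewrite -[X in measurable X]setTI.
    rewrite (_ : [set w | _] = (mu_n \o sample X) @^-1` `]-oo, mu - Delta[%classic).
      exact: mest.
    by apply/funext => w /=; rewrite in_itv/= ltrBlDl.
  (* Now [theta = mu - Delta] lies strictly above the estimator, so the sum of the [psi] terms is
     nonpositive and that of their opposites nonnegative. *)
  + move=> w /= est_lt; rewrite sumrN oppr_ge0.
    rewrite (eq_bigr (fun i => psi (tnth (sample X w) i - (mu - Delta)))).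
      by apply: (estim _).2; rewrite -ltrBlDl.
    by move=> i _; rewrite sampleE opprB addrCA addrC.
Qed.
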